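(* Let $X$ be a path-connected ANR space. Then $$\mathsf{TC}^{FH}(X)=\mathsf{TC}^{FH}_g(X)=\mathsf{TC}^{DM}(X)=\mathsf{TC}^{M}(X)=\mathsf{TC}^M_g(X).$$
   Context: An ANR is a metrizable space $X$ such that every continuous map $f\colon A\to X$ from a closed subset $A$ of a metrizable space $Y$ extends continuously over an open neighborhood of $A$ in $Y$. Let $e_{01}\colon X^{[0,1]}\to X\times X$, $\gamma\mapsto(\gamma(0),\gamma(1))$, $\Delta X=\{(x,x):x\in X\}$, and $c_x$ the constant path at $x$. All invariants below are the least nonnegative integer $n$ for which the described structure exists, and $\infty$ if none exists: (i) $\mathsf{TC}^M(X)$: an open cover $\{U_0,\ldots,U_n\}$ of $X\times X$ with $\Delta X\subseteq U_i$ for every $i$, and continuous sections $s_i\colon U_i\to X^{[0,1]}$ of $e_{01}$ with $s_i(x,x)=c_x$ for all $x$. (ii) $\mathsf{TC}^M_g(X)$: same as (i) but the sets $U_i$ need not be open. (iii) $\mathsf{TC}^{DM}(X)$: an open cover $\{U_0,\ldots,U_n\}$ of $X\times X$ with continuous sections $s_i\colon U_i\to X^{[0,1]}$ of $e_{01}$ such that $s_i(x,x)=c_x$ whenever $(x,x)\in U_i$. (iv) $\mathsf{TC}^{FH}(X)$: an open cover $\{U_0,\ldots,U_n\}$ of $X\times X$ with continuous sections $s_i\colon U_i\to X^{[0,1]}$ of $e_{01}$ such that $\Delta X\subseteq U_0$, $s_0(x,x)=c_x$ for all $x\in X$, and $\Delta X\cap U_i=\varnothing$ for all $i\ge1$.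 (v) $\mathsf{TC}^{FH}_g(X)$: same as (iv) but the sets $U_i$ need not be open. *)

(* Defs.v *)
From HB Require Import structures.
From mathcomp Require Import all_boot all_order all_algebra.
From mathcomp Require Import all_classical all_reals all_analysis.

Set Implicit Arguments.
Unset Strict Implicit.
Unset Printing Implicit Defensive.

Import Order.TTheory GRing.Theory Num.Theory.
Import numFieldTopology.Exports numFieldNormedType.Exports.
Local Open Scope classical_set_scope.
Local Open Scope ring_scope.

Notation I01 R := (set_type [set` (`[0, 1] : interval R)%R]).

Section Defs.
Variable R : realType.

Lemma I01_0_subproof : (0:R) \in [set` (`[0, 1] : interval R)%R].
Proof. by apply/mem_set; rewrite /= in_itv /= lexx ler01. Qed.
Lemma I01_1_subproof : (1:R) \in [set` (`[0, 1] : interval R)%R].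
Proof. by apply/mem_set; rewrite /= in_itv /= lexx ler01. Qed.

Definition i0 : I01 R := exist _ 0 I01_0_subproof.
Definition i1 : I01 R := exist _ 1 I01_1_subproof.

Definition metrizable (T : topologicalType) : Prop :=
  exists d : T -> T -> R,
    [/\ (forall x y, 0 <= d x y),
        (forall x y, d x y = 0 <-> x = y),
        (forall x y, d x y = d y x),
        (forall x y z, d x z <= d x y + d y z) &
        (forall A : set T, open A <->
           (forall x, A x -> exists2 e : R, 0 < e & [set y | d x y < e] `<=` A))].

Definition ANR (X : topologicalType) : Prop :=
  metrizable X /\
  forall (Y : topologicalType), metrizable Y ->
  forall (A : set Y) (f : Y -> X), closed A -> {within A, continuous f} ->
  exists (U : set Y) (g : Y -> X),
    [/\ open U, A `<=` U, {within U, continuous g} & {in A, f =1 g}].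

Definition path_connected (X : topologicalType) : Prop :=
  forall x y : X, exists g : I01 R -> X, [/\ continuous g, g i0 = x & g i1 = y].

(** Free path space X^[0,1] (ambient function space with the compact-open
    topology; membership in X^[0,1] means continuity). *)
Definition pathsp (X : topologicalType) := {compact-open, I01 R -> X}.

Definition const_path (X : topologicalType) (x : X) : pathsp X := fun _ => x.

Definition section_over (X : topologicalType) (U : set (X * X))
    (s : X * X -> pathsp X) : Prop :=
  {within U, continuous s} /\
  forall z, U z ->
    [/\ continuous (s z : I01 R -> X), s z i0 = z.1 & s z i1 = z.2].

Definition diagonal (X : Type) : set (X * X) := [set z | z.1 = z.2].

Definition least_or_inf (P : nat -> Prop) : option nat :=
  match pselect (exists n, P n) with
  | left h => Some (ex_minn (P := fun n => `[< P n >])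
                     (let: ex_intro n hn := h in ex_intro _ n (asboolT hn)))
  | right _ => None
  end.

Section TC.
Variable X : topologicalType.

Definition TCM_cover (n : nat) : Prop :=
  exists (U : 'I_n.+1 -> set (X * X)) (s : 'I_n.+1 -> X * X -> pathsp X),
    [/\ (forall i, open (U i)), (\bigcup_i U i = setT),
        (forall i, @diagonal X `<=` U i),
        (forall i, section_over (U i) (s i)) &
        (forall i x, s i (x, x) = const_path x)].

Definition TCMg_cover (n : nat) : Prop :=
  exists (U : 'I_n.+1 -> set (X * X)) (s : 'I_n.+1 -> X * X -> pathsp X),
    [/\ (\bigcup_i U i = setT),
        (forall i, @diagonal X `<=` U i),
        (forall i, section_over (U i) (s i)) &
        (forall i x, s i (x, x) = const_path x)].

Definition TCDM_cover (n : nat) : Prop :=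
  exists (U : 'I_n.+1 -> set (X * X)) (s : 'I_n.+1 -> X * X -> pathsp X),
    [/\ (forall i, open (U i)), (\bigcup_i U i = setT),
        (forall i, section_over (U i) (s i)) &
        (forall i x, U i (x, x) -> s i (x, x) = const_path x)].

Definition TCFH_cover (n : nat) : Prop :=
  exists (U : 'I_n.+1 -> set (X * X)) (s : 'I_n.+1 -> X * X -> pathsp X),
    [/\ (forall i, open (U i)), (\bigcup_i U i = setT),
        (forall i, section_over (U i) (s i)),
        @diagonal X `<=` U ord0 /\
        (forall x, s ord0 (x, x) = const_path x) &
        (forall i : 'I_n.+1, (0 < i)%N -> @diagonal X `&` U i = set0)].

Definition TCFHg_cover (n : nat) : Prop :=
  exists (U : 'I_n.+1 -> set (X * X)) (s : 'I_n.+1 -> X * X -> pathsp X),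
    [/\ (\bigcup_i U i = setT),
        (forall i, section_over (U i) (s i)),
        @diagonal X `<=` U ord0,
        (forall x, s ord0 (x, x) = const_path x) &
        (forall i : 'I_n.+1, (0 < i)%N -> @diagonal X `&` U i = set0)].

Definition TCM := least_or_inf TCM_cover.
Definition TCMg := least_or_inf TCMg_cover.
Definition TCDM := least_or_inf TCDM_cover.
Definition TCFH := least_or_inf TCFH_cover.
Definition TCFHg := least_or_inf TCFHg_cover.
End TC.
End Defs.

(* Main.v *)
(**
A section over an arbitrary subset U of X * X which is constant on the diagonal
need not extend to a neighborhood of U, but it can be replaced by such a section
over an open W containing U. Put U at height 0 below (X * X) * ]0, oo[: inside
U * {0} `|` (X * X) * ]0, oo[ the set U * {0} is closed, whatever U is. The ANR
property thus extends the homotopy underlying the section to some open V, and the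
new section follows V at a small positive continuous height. Hence FHg implies DM
and Mg implies M. For DM implies Mg, shrink the open cover to a closed one: on the
union of a closed member with the diagonal, the section glues with the constant
paths. For M implies FH, remove the diagonal from all members but the first.
*)

Require Import Defs.
From HB Require Import structures.
From mathcomp Require Import all_boot all_order all_algebra.
From mathcomp Require Import all_classical all_reals all_analysis.

Set Implicit Arguments.
Unset Strict Implicit.
Unset Printing Implicit Defensive.

Import Order.TTheory GRing.Theory Num.Theory.
Import numFieldTopology.Exports numFieldNormedType.Exports.
Local Open Scope classical_set_scope.
Local Open Scope ring_scope.

(** * Metrizability of products, subspaces and the real line; compactness of the interval *)

Section metrics.
Variable R : realType.

Definition metrizes (T : topologicalType) (d : T -> T -> R) : Prop :=
  [/\ (forall x y, 0 <= d x y),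
      (forall x y, d x y = 0 <-> x = y),
      (forall x y, d x y = d y x),
      (forall x y z, d x z <= d x y + d y z) &
      (forall A : set T, open A <->
         (forall x, A x -> exists2 e : R, 0 < e & [set y | d x y < e] `<=` A))].

Lemma metrizes_nbhs (T : topologicalType) (d : T -> T -> R) (x : T)
    (A : set T) : metrizes d ->
  nbhs x A <-> exists2 e : R, 0 < e & [set y | d x y < e] `<=` A.
Proof.
move=> [d0 dE dC dT dO]; split.
  rewrite nbhsE => -[B [/dO oB /oB[e e0 eB]] BA]; exists e => //.
  exact: subset_trans BA.
move=> [e e0 eA]; apply: (filterS eA); apply: open_nbhs_nbhs; split; last first.
  by rewrite /= (dE x x).2.
apply/dO => y /= dxy; exists (e - d x y); first by rewrite subr_gt0.
by move=> z /=; rewrite ltrBrDl; apply: le_lt_trans.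
Qed.

(** Neighbourhoods in product and initial topologies are given pointwise, so this form of the last
    clause of [metrizes] is the convenient one to check. *)
Lemma nbhs_metrizes (T : topologicalType) (d : T -> T -> R) :
  (forall x y, 0 <= d x y) -> (forall x y, d x y = 0 <-> x = y) ->
  (forall x y, d x y = d y x) -> (forall x y z, d x z <= d x y + d y z) ->
  (forall (x : T) (A : set T), nbhs x A <->
     exists2 e : R, 0 < e & [set y | d x y < e] `<=` A) ->
  metrizes d.
Proof.
move=> d0 dE dC dT nE; split => // A; rewrite openE.
by split=> H x /H /nE.
Qed.

Lemma metrizable_hausdorff (T : topologicalType) :
  metrizable R T -> hausdorff_space T.
Proof.
move=> [d hd]; have nE := fun x A => metrizes_nbhs x A hd.
have [d0 dE dC dT _] := hd; move=> x y cxy; apply/dE.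
apply/eqP; rewrite eq_le d0 andbT leNgt; apply/negP => dxy.
have e0 : 0 < d x y / 2 by rewrite divr_gt0.
have [||z [/= xz yz]] := cxy [set z | d x z < d x y / 2]
    [set z | d y z < d x y / 2].
- by apply/nE; exists (d x y / 2).
- by apply/nE; exists (d x y / 2).
have := dT x z y; rewrite leNgt [X in _ < X]splitr (dC z y) => /negP; apply.
exact: ltrD.
Qed.

Lemma metrizable_prod (T U : topologicalType) :
  metrizable R T -> metrizable R U -> metrizable R (T * U)%type.
Proof.
move=> [d hd] [d' hd'].
have nE := fun x A => metrizes_nbhs x A hd.
have nE' := fun x A => metrizes_nbhs x A hd'.
have [d0 dE dC dT _] := hd; have [d'0 d'E d'C d'T _] := hd'.
exists (fun p q => Num.max (d p.1 q.1) (d' p.2 q.2)); apply: nbhs_metrizes.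
- by move=> p q; rewrite le_max d0.
- move=> [p1 p2] [q1 q2] /=; split=> [m0|[<- <-]]; last first.
    by rewrite (dE _ _).2// (d'E _ _).2// maxxx.
  have: Num.max (d p1 q1) (d' p2 q2) <= 0 by rewrite m0.
  rewrite ge_max => /andP[h h']; congr pair.
    by apply/dE/eqP; rewrite eq_le h d0.
  by apply/d'E/eqP; rewrite eq_le h' d'0.
- by move=> p q; rewrite dC d'C.
- move=> p q r; rewrite ge_max; apply/andP; split.
    by apply: (le_trans (dT _ q.1 _)); rewrite lerD// le_max lexx.
  by apply: (le_trans (d'T _ q.2 _)); rewrite lerD// le_max lexx orbT.
move=> [x y] A; split.
  move=> [[B C] /= [/nE[e e0 eB] /nE'[e' e'0 eC]] BCA].
  exists (Num.min e e'); first by rewrite lt_min e0.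
  move=> [z w] /=; rewrite lt_min !gt_max => /andP[/andP[h _] /andP[_ h']].
  by apply: BCA; split => /=; [exact: eB|exact: eC].
move=> [e e0 eA]; exists ([set z | d x z < e], [set z | d' y z < e]).
  by split; [apply/nE|apply/nE']; exists e.
by move=> [z w] [/= h h']; apply: eA; rewrite /= gt_max h.
Qed.

Lemma metrizable_set_type (T : topologicalType) (P : set T) :
  metrizable R T -> metrizable R (set_type P).
Proof.
move=> [d hd]; have nE := fun x A => metrizes_nbhs x A hd.
have [d0 dE dC dT _] := hd.
exists (fun x y => d (\val x) (\val y)); apply: nbhs_metrizes => //.
- by move=> x y; rewrite dE; split=> [/val_inj|->].
move=> x A; split.
  move=> [_ [[B oB <-] Bx] BA].
  have [e e0 eB] := (nE _ _).1 (open_nbhs_nbhs (conj oB Bx)).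
  by exists e => // y /eB By; exact: BA.
move=> [e e0 eA]; apply: filterS eA _.
have : continuous (\val : set_type P -> T) by exact: initial_continuous.
by move=> /(_ x [set y | d (\val x) y < e]); apply; apply/nE; exists e.
Qed.

Lemma metrizable_R : metrizable R R.
Proof.
exists (fun x y => `|x - y|); apply: nbhs_metrizes.
- by move=> x y; exact: normr_ge0.
- by move=> x y; split=> [/eqP|->]; rewrite ?subrr ?normr0// normr_eq0 subr_eq0 => /eqP.
- by move=> x y; rewrite distrC.
- by move=> x y z; exact: ler_distD.
by move=> x A; split=> [/nbhs_ballP|H]; last apply/nbhs_ballP.
Qed.

(** The subtype is the image of the compact real segment under [insubd (i0 R)], which is continuous
    there because following it by the inclusion gives the identity of the segment. *)
Lemma compact_I01 : compact [set: I01 R].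
Proof.
have -> : [set: I01 R] = insubd (i0 R) @` `[0, 1]%classic.
  apply/esym/seteqP; split => // x _; exists (\val x).
    exact: set_mem (valP x).
  exact: valKd.
apply: continuous_compact; last exact: segment_compact.
apply: continuous_comp_initial; apply: subspace_eq_continuous (_ : {within _, continuous id}).
  by move=> x x01; exact: esym (insubdK (i0 R) x01).
by apply: continuous_subspaceT => x; exact: cvg_id.
Qed.

End metrics.

(** * Continuous gauges *)

Section gauge.
Variable R : realType.

(** Symmetry of [d] turns the one-sided bound into a two-sided one. *)
Lemma lipschitz1_continuous (T : topologicalType) (d : T -> T -> R)
    (f : T -> R) :
  metrizes d -> (forall x y, f x <= f y + d x y) -> continuous f.
Proof.
move=> hd fL x; have [_ _ dC _ _] := hd.
apply/cvgrPdist_lt => e e0; apply/(metrizes_nbhs _ _ hd); exists e => // y /= dxy.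
rewrite ltr_distl; apply/andP; split.
  by rewrite ltrBlDr (le_lt_trans (fL y x))// ltrD2l dC.
by rewrite (le_lt_trans (fL x y))// ltrD2l.
Qed.

(** Supplies the height of the extended sections: [delta] is positive on an open set, and positive
    heights below its graph stay in [N]. For [N] independent of [r], it plays the role of a distance
    to the complement. *)
Lemma exists_gauge (T : topologicalType) (N : set (T * R)) :
  metrizable R T ->
  exists delta : T -> R,
    [/\ continuous delta,
        (forall z, (\forall p \near (z, 0 : R), 0 < p.2 -> N p) -> 0 < delta z) &
        (forall z (r : R), 0 < r < delta z -> N (z, r))].
Proof.
move=> [d hd]; have [d0 dE dC dT _] := hd.
(* [sup (E z)] is 1-Lipschitz: [e] in [E z] gives [e - d z z'] in [E z']. *)
pose E z := [set e : R | 0 <= e <= 1 /\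
  forall z' (r : R), d z z' < e -> 0 < r < e -> N (z', r)].
(* The supremum makes sense: 0 lies in [E z] because its condition on [r] is void, and the cap at 1
   bounds [E z] even where [N] is everything. *)
have E0 z : E z 0.
  by split=> [|z' r _ /andP[r0 /(lt_trans r0)]]; rewrite ?lexx ?ler01 ?ltxx.
have Eub z : has_ubound (E z) by exists 1 => e [/andP[]].
exists (fun z => sup (E z)); split.
- apply: (lipschitz1_continuous hd) => x y; apply: ge_sup; first by exists 0.
  move=> e [/andP[e0 e1] eN]; rewrite -lerBlDr.
  have [ed|/ltW de] := leP e (d x y).
    apply: (@le_trans _ _ 0); first by rewrite subr_le0.
    exact: ub_le_sup.
  apply: ub_le_sup => //; split.
    by rewrite subr_ge0 de lerBlDr (le_trans e1)// lerDl.
  move=> z' r; rewrite ltrBrDl => yz' /andP[r0 re]; apply: eN.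
    exact: le_lt_trans yz'.
  by rewrite r0 (lt_le_trans re)// gerBl.
- move=> z [[A B] /= [/(metrizes_nbhs _ _ hd)[e e0 eA] /nbhs_ballP[e' /= e'0 eB]] AB].
  pose m := Num.min 1 (Num.min e e').
  have m0 : 0 < m by rewrite !lt_min ltr01 e0.
  apply: (lt_le_trans m0); apply: ub_le_sup => //; split.
    by rewrite (ltW m0) ge_min lexx.
  move=> z' r; rewrite !lt_min => /andP[_ /andP[ze _]] /andP[r0 /andP[_ /andP[_ re]]].
  apply: (AB (z', r)) => //; split; first exact: eA.
  by apply: eB; rewrite /ball /= sub0r normrN gtr0_norm.
- move=> z r /andP[r0 rs].
  have [e [_ eN] re] := sup_gt (ex_intro _ 0 (E0 z)) rs.
  apply: eN; last by rewrite r0.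
  by rewrite (dE z z).2// (lt_trans r0).
Qed.

End gauge.

(** * Equalizers and pairing of continuous maps *)

Lemma closed_equalizer (S T : topologicalType) (f g : S -> T) :
  hausdorff_space T -> continuous f -> continuous g ->
  closed [set x | f x = g x].
Proof.
move=> hT cf cg; rewrite -openC openE => x /eqP fgx.
move: hT; rewrite open_hausdorff => /(_ _ _ fgx)[[A B] /= [/set_mem Ax /set_mem Bx]].
move=> [oA oB /eqP AB0].
have nA : nbhs x (f @^-1` A) by apply: cf; exact: open_nbhs_nbhs.
have nB : nbhs x (g @^-1` B) by apply: cg; exact: open_nbhs_nbhs.
apply: filterS (filterI nA nB) => y [/= Ay By] fgy.
have : (A `&` B) (f y) by split; rewrite // fgy.
by rewrite AB0.
Qed.

Lemma continuous_pair (S T U : topologicalType) (f : S -> T) (g : S -> U) :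
  continuous f -> continuous g -> continuous (fun x => (f x, g x)).
Proof. by move=> cf cg x; apply: cvg_pair; [exact: cf|exact: cg]. Qed.

(** * Extending a section to an open set *)

Section sections.
Variables (R : realType) (X : topologicalType).

(** The interval is compact Hausdorff, so continuity into the compact-open topology amounts to joint
    continuity. This turns a section into a map with values in [X], to which the ANR property
    applies. *)
Lemma uncurry_section (U : set (X * X)) (s : X * X -> pathsp R X) :
  section_over U s ->
  continuous (fun p : set_type U * I01 R => s (\val p.1) p.2).
Proof.
move=> [/subspace_sigL_continuousP cs sP].
have -> : (fun p : set_type U * I01 R => s (\val p.1) p.2) = uncurry (sigL U s).
  by apply/funext => -[].
apply: continuous_uncurry => //.
- move=> t _; rewrite withinET; exists setT; first exact: filterT.
  by split; [exact: compact_I01|exact: closedT].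
- by apply/(@metrizable_hausdorff R)/metrizable_set_type/metrizable_R.
- by move=> u; case: (sP _ (set_valP u)).
Qed.

Lemma const_path_continuous : continuous (@const_path R X).
Proof. exact: (@continuous_curry_fun _ _ _ (@fst X (I01 R)) (fun=> @cvg_fst _ _ _ _ _)). Qed.

Lemma extend_section (U : set (X * X)) (s : X * X -> pathsp R X) :
  ANR R X -> section_over U s ->
  (forall x, U (x, x) -> s (x, x) = @const_path R X x) ->
  exists (W : set (X * X)) (s' : X * X -> pathsp R X),
    [/\ open W, U `<=` W, section_over W s' &
        forall x, W (x, x) -> s' (x, x) = @const_path R X x].
Proof.
move=> [mX extX] sU sdiag.
have cs := uncurry_section sU; have [_ sP] := sU.
have mI : metrizable R (I01 R) by exact/metrizable_set_type/metrizable_R.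
have mT : metrizable R ((X * X) * R * I01 R)%type.
  by do !apply: metrizable_prod => //; exact: metrizable_R.
have hX := metrizable_hausdorff mX; have hI := metrizable_hausdorff mI.
(* Fixing f on the faces t = 0, 1 and over the diagonal at every height r makes
   the extension a section with constant paths; heights r < 0 are harmless. *)
pose P : set ((X * X) * R * I01 R) := [set p | 0 < p.1.2 \/ U p.1.1].
pose Y := set_type P.
pose zy (y : Y) : X * X := (\val y).1.1.
pose ry (y : Y) : R := (\val y).1.2.
pose ty (y : Y) : I01 R := (\val y).2.
have cval : continuous (\val : Y -> _) by exact: initial_continuous.
have cT : continuous ty.
  by move=> y; apply: (continuous_comp (cval y)); exact: cvg_snd.
have c1 : continuous (fun y : Y => (\val y).1).
  by move=> y; apply: (continuous_comp (cval y)); exact: cvg_fst.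
have cz : continuous zy.
  by move=> y; apply: (continuous_comp (c1 y)); exact: cvg_fst.
have cr : continuous ry.
  by move=> y; apply: (continuous_comp (c1 y)); exact: cvg_snd.
have cz1 : continuous (fun y => (zy y).1).
  by move=> y; apply: (continuous_comp (cz y)); exact: cvg_fst.
have cz2 : continuous (fun y => (zy y).2).
  by move=> y; apply: (continuous_comp (cz y)); exact: cvg_snd.
pose f (y : Y) : X :=
  if (ty y == i0 R) || ((zy y).1 == (zy y).2) then (zy y).1
  else if ty y == i1 R then (zy y).2 else s (zy y) (ty y).
pose A1 : set Y := [set y | ty y = i0 R].
pose A2 : set Y := [set y | (zy y).1 = (zy y).2].
pose A3 : set Y := [set y | ty y = i1 R].
pose A4 : set Y := ry @^-1` [set r | r <= 0].
have cA1 : closed A1 by exact: (closed_equalizer hI cT (@cst_continuous _ _ _)).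
have cA2 : closed A2 by exact: closed_equalizer.
have cA3 : closed A3 by exact: (closed_equalizer hI cT (@cst_continuous _ _ _)).
have cA4 : closed A4.
  exact: (continuous_closedP _).1 cr _ (@closed_le _ 0).
have A4U y : A4 y -> U (zy y).
  by rewrite /A4 /= leNgt => /negP r0; have [//|] := set_mem (valP y).
have f1 y : A1 y -> f y = (zy y).1 by rewrite /f => ->; rewrite eqxx.
have f2 y : A2 y -> f y = (zy y).1.
  by rewrite /f /A2 /= => ->; rewrite eqxx orbT.
have f3 y : A3 y -> f y = (zy y).2.
  rewrite /f => ->; rewrite eqxx; case: ifPn => // /orP[|/eqP//].
  by move=> /eqP/(congr1 \val)/eqP; rewrite /= oner_eq0.
have f4 y : A4 y -> f y = s (zy y) (ty y).
  move=> /A4U Uz; have [_ s0 s1] := sP _ Uz; rewrite /f.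
  case: eqP => [->//|_ /=]; case: eqP => [zz|_]; last by case: eqP => [->|].
  by move: Uz; rewrite [zy y]surjective_pairing -zz => /sdiag ->.
have cf : {within A1 `|` A2 `|` A3 `|` A4, continuous f}.
  apply: withinU_continuous => //; first by do ?apply: closedU.
    apply: withinU_continuous => //; first exact: closedU.
      apply: withinU_continuous => //.
        apply: subspace_eq_continuous (continuous_subspaceT cz1) => y.
        by move=> /set_mem/f1.
      apply: subspace_eq_continuous (continuous_subspaceT cz1) => y.
      by move=> /set_mem/f2.
    apply: subspace_eq_continuous (continuous_subspaceT cz2) => y.
    by move=> /set_mem/f3.
  (* On [A4] the map [f] factors through [set_type U * I01 R], where the uncurried section is
     continuous; [k] is the first component. *)
  apply/subspace_sigL_continuousP.
  pose k (y : set_type A4) : set_type U :=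
    exist _ (zy (\val y)) (mem_set (A4U _ (set_mem (valP y)))).
  have cv : continuous (\val : set_type A4 -> Y) by exact: initial_continuous.
  have ck : continuous k.
    apply: continuous_comp_initial => y.
    exact: (continuous_comp (cv y) (cz _)).
  have -> : sigL A4 f = (fun p => s (\val p.1) p.2) \o (fun y => (k y, ty (\val y))).
    by apply/funext => y; exact: f4 (set_mem (valP y)).
  move=> y; apply: continuous_comp; last exact: cs.
  apply: continuous_pair => // z.
  exact: (continuous_comp (cv z) (cT _)).
have cA : closed (A1 `|` A2 `|` A3 `|` A4) by do !apply: closedU.
have [V [g [oV AV cg fg]]] := extX Y (metrizable_set_type _ mT) _ f cA cf.
(* [V] is the trace on [Y] of an open [G] of the ambient product. The gauge is taken for the pairs
   [(z, r)] whose whole segment [t] in [I01 R] lies in [G]. *)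
have [G oG GV] := oV.
have [delta [cd dP dN]] :=
  exists_gauge [set q | forall t, G (q, t)] (metrizable_prod mX mX).
have Ud z : U z -> 0 < delta z.
  move=> Uz; apply: dP.
  (* Tube lemma: [G] contains the segment over [(z, 0)], hence by compactness all segments over a
     neighbourhood of [(z, 0)]. *)
  have : \forall q \near (z, 0 : R), [set: I01 R] `<=` (fun t => G (q, t)).
    have /compact_near_coveringP cptI := @compact_I01 R.
    apply: (cptI _ _ (fun q t => G (q, t)) (nbhs_filter _)) => t _.
    have : nbhs ((z, 0 : R), t) G.
      apply: open_nbhs_nbhs; split => //.
      have Pzt : P ((z, 0), t) by right.
      have : V (exist _ (z, 0, t) (mem_set Pzt)) by apply: AV; right; rewrite /A4 /=.
      by rewrite -GV.
    move=> [[B C] [nB nC] BC]; exists (C, B) => // -[t' q] [Ct' Bq].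
    exact: (BC (q, t')).
  by apply: filterS => q Oq _ t; exact: Oq.
pose W := [set z | 0 < delta z].
(* Half the gauge is strictly below it. The default 1 keeps the height positive off [W], so that
   [(z, eps z, t)] always lies in [P]. *)
pose eps (z : X * X) := if 0 < delta z then delta z / 2 else 1.
have epsE z : W z -> eps z = delta z / 2 by rewrite /eps /W /= => ->.
have eps0 z : 0 < eps z by rewrite /eps; case: ifPn => // z0; rewrite divr_gt0.
pose y (z : X * X) t : Y :=
  exist _ (z, eps z, t) (mem_set (or_introl (eps0 z) : P (z, eps z, t))).
have yV z t : W z -> V (y z t).
  move=> Wz; rewrite -GV /=; apply: (dN z (eps z)).
  by rewrite eps0 epsE// gtr_pMr// invf_lt1// ltr1n.
have gE z t : (A1 `|` A2 `|` A3 `|` A4) (y z t) -> g (y z t) = f (y z t).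
  by move=> /mem_set/fg.
pose s' (z : X * X) : pathsp R X := fun t => g (y z t).
have cgV : {in V, continuous g} by rewrite -continuous_open_subspace.
have cu : continuous (fun p : set_type W * I01 R => g (y (\val p.1) p.2)).
  move=> p; apply: (@continuous_comp _ _ _
    (fun p : set_type W * I01 R => y (\val p.1) p.2)); last first.
    by apply: cgV; apply/mem_set/yV/set_mem/valP.
  move: p; apply: continuous_comp_initial.
  have cv : continuous (fun p : set_type W * I01 R => \val p.1).
    by move=> p; apply: continuous_comp; [exact: cvg_fst|exact: initial_continuous].
  (* Over [W] the case distinction in [eps] disappears, leaving the continuous height
     [delta / 2]. *)
  have -> : set_val \o (fun p : set_type W * I01 R => y (\val p.1) p.2) =
      (fun p => ((\val p.1, delta (\val p.1) / 2), p.2)).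
    by apply/funext => p; rewrite -epsE//; exact: set_mem (valP p.1).
  apply: continuous_pair; last by move=> p; exact: cvg_snd.
  apply: continuous_pair => // p.
  by apply: cvgMl; exact: (continuous_comp (cv p) (cd _)).
have [cs' cs't] := continuous_curry cu.
exists W, s'; split => //.
- by apply: (@open_comp _ _ delta [set x | 0 < x]) => [z _|]; [exact: cd|exact: open_gt].
- split; first exact/subspace_sigL_continuousP.
  move=> z Wz; split.
  + exact: (cs't (exist _ z (mem_set Wz))).
  + rewrite /s' gE ?f1//; last by do 3 left.
  + rewrite /s' gE ?f3//; last by left; right.
- move=> x Wx; apply/funext => t; rewrite /s' gE ?f2//; last by left; left; right.
Qed.
End sections.

(** * Closed shrinkings of finite open covers *)

Lemma closed_shrinking (R : realType) (T : topologicalType) (I : finType)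
    (U : I -> set T) :
  metrizable R T -> (forall i, open (U i)) -> \bigcup_i U i = setT ->
  exists C : I -> set T,
    [/\ forall i, closed (C i), forall i, C i `<=` U i & \bigcup_i C i = setT].
Proof.
move=> mT oU cU.
have /choice[delta dP] i := exists_gauge [set q | U i q.1] mT.
have dU i z : U i z -> 0 < delta i z.
  move=> Uz; have [_ + _] := dP i; apply.
  exists (U i, setT) => [|[z' r] [Uz' _] _] //=.
  by split; [exact: open_nbhs_nbhs|exact: filterT].
(* [C i] is where the gauge of [U i] is the largest. Some gauge is positive at each point, so the
   largest is too, which puts the point in [U i]; finiteness of [I] makes the maximum attained. *)
exists (fun i => \bigcap_j [set z | delta j z <= delta i z]); split=> [i|i z Cz|].
- apply: closed_bigI => j _.
  have -> : [set z | delta j z <= delta i z] =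
      (delta i \- delta j) @^-1` [set r | 0 <= r].
    by apply/seteqP; split=> z /=; rewrite subr_ge0.
  apply: (continuous_closedP _).1 (@closed_ge _ 0) => z.
  by have [ci _ _] := dP i; have [cj _ _] := dP j; exact: cvgB (ci z) (cj z).
- have [j _ Ujz] : (\bigcup_i U i) z by rewrite cU.
  have iz : 0 < delta i z := lt_le_trans (dU _ _ Ujz) (Cz j Logic.I).
  have [_ _ /(_ z (delta i z / 2))] := dP i; apply.
  by rewrite divr_gt0//= gtr_pMr// invf_lt1// ltr1n.
- apply/seteqP; split => // z _; have [i0 _ _] : (\bigcup_i U i) z by rewrite cU.
  case: (@arg_maxP _ R _ i0 xpredT (delta^~ z) isT) => i _ iM.
  by exists i => // j _; exact: iM.
Qed.

(** * The cycle of implications between the kinds of covers *)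

Section covers.
Variables (R : realType) (X : topologicalType).
Hypothesis ANR_X : ANR R X.

Let metX : metrizable R X. Proof. by case: ANR_X. Qed.

Lemma closed_diagonal : closed (@diagonal X).
Proof.
apply: (closed_equalizer (metrizable_hausdorff metX)) => z.
  exact: cvg_fst.
exact: cvg_snd.
Qed.

Lemma diagonalE (z : X * X) : diagonal z -> z = (z.1, z.1).
Proof. by case: z => x y; rewrite /diagonal /= => ->. Qed.

Lemma section_overW (U V : set (X * X)) (s : X * X -> pathsp R X) :
  U `<=` V -> section_over V s -> section_over U s.
Proof.
by move=> UV [cs sP]; split=> [|z /UV/sP//]; exact: continuous_subspaceW cs.
Qed.

Lemma extend_sections n (U : 'I_n.+1 -> set (X * X))
    (s : 'I_n.+1 -> X * X -> pathsp R X) :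
  \bigcup_i U i = setT -> (forall i, section_over (U i) (s i)) ->
  (forall i x, U i (x, x) -> s i (x, x) = @const_path R X x) ->
  exists (W : 'I_n.+1 -> set (X * X)) (s' : 'I_n.+1 -> X * X -> pathsp R X),
    [/\ (forall i, open (W i)) /\ \bigcup_i W i = setT,
        forall i, U i `<=` W i, forall i, section_over (W i) (s' i) &
        forall i x, W i (x, x) -> s' i (x, x) = @const_path R X x].
Proof.
move=> cU sU sd.
have /choice[W /choice[s' WP]] i := extend_section ANR_X (sU i) (sd i).
exists W, s'; split; last 3 first.
- by move=> i; have [] := WP i.
- by move=> i; have [] := WP i.
- by move=> i; have [] := WP i.
split=> [i|]; first by have [] := WP i.
apply/seteqP; split => // z _; have [i _ Uz] : (\bigcup_i U i) z by rewrite cU.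
by exists i => //; have [_ UW _ _] := WP i; exact: UW.
Qed.

Lemma TCFH_FHg n : TCFH_cover R X n -> TCFHg_cover R X n.
Proof. by move=> [U [s [_ cU sU [dU sd] dU']]]; exists U, s. Qed.

Lemma TCFHg_DM n : TCFHg_cover R X n -> TCDM_cover R X n.
Proof.
move=> [U [s [cU sU dU sd dU0]]].
have [|W [s' [[oW cW] UW sW sWd]]] := extend_sections cU sU.
  (* Only member 0 meets the diagonal; for the others the condition on constant paths is void. *)
  move=> i x Ux; have [i0|ipos] := posnP i.
    by rewrite (_ : i = ord0) //; exact: val_inj.
  by have : (@diagonal X `&` U i) (x, x) by []; rewrite dU0.
by exists W, s'.
Qed.

Lemma TCDM_Mg n : TCDM_cover R X n -> TCMg_cover R X n.
Proof.
move=> [U [s [oU cU sU sd]]].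
have [C [clC CU cC]] := closed_shrinking (metrizable_prod metX metX) oU cU.
(* The two formulas agree where [C i] meets the diagonal, by [sd]. Both sets are closed, so
   continuity on the union can be checked on each. *)
pose s' i z : pathsp R X := if z.1 == z.2 then @const_path R X z.1 else s i z.
have s'd i z : @diagonal X z -> s' i z = @const_path R X z.1.
  by rewrite /s' /diagonal /= => ->; rewrite eqxx.
have s'C i z : C i z -> s' i z = s i z.
  rewrite /s' => /CU Uz; case: eqP => // /diagonalE zE.
  by rewrite [in RHS]zE sd//= -zE.
exists (fun i => C i `|` @diagonal X), s'; split.
- apply/seteqP; split => // z _; have [i _ Cz] : (\bigcup_i C i) z by rewrite cC.
  by exists i => //; left.
- by move=> i z; right.
- move=> i; split.
    apply: withinU_continuous => //; first exact: closed_diagonal.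
      apply: subspace_eq_continuous (section_overW (@CU i) (sU i)).1 => z.
      by move=> /set_mem/s'C.
    have cc : continuous (fun z : X * X => @const_path R X z.1 : pathsp R X).
      move=> z; apply: continuous_comp; first exact: cvg_fst.
      exact: const_path_continuous.
    apply: subspace_eq_continuous (continuous_subspaceT cc) => z.
    by move=> /set_mem dz; exact: esym (s'd i z dz).
  move=> z [Cz|dz].
    by rewrite s'C//; have [_ +] := sU i; apply; exact: CU.
  by rewrite s'd//; split => //; exact: cst_continuous.
- by move=> i x; rewrite s'd.
Qed.

Lemma TCMg_M n : TCMg_cover R X n -> TCM_cover R X n.
Proof.
move=> [U [s [cU dU sU sd]]].
have [|W [s' [[oW cW] UW sW sWd]]] := extend_sections cU sU.
  by move=> i x _; exact: sd.
exists W, s'; split => //.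
  by move=> i; exact: subset_trans (UW i).
by move=> i x; apply: sWd; apply/UW/dU.
Qed.

Lemma TCM_FH n : TCM_cover R X n -> TCFH_cover R X n.
Proof.
move=> [U [s [oU cU dU sU sd]]].
exists (fun i => if i == ord0 then U i else U i `\` @diagonal X), s; split.
- move=> i; case: ifP => // _; rewrite setDE; apply: openI => //.
  exact: closed_openC closed_diagonal.
- apply/seteqP; split => // z _; have [dz|ndz] := pselect (@diagonal X z).
    by exists ord0 => //=; exact: dU.
  have [i _ Uz] : (\bigcup_i U i) z by rewrite cU.
  by exists i => //=; case: ifP.
- by move=> i; apply: section_overW (sU i); case: ifP => _ z // [].
- by split; [exact: dU|exact: sd].
- move=> i i0; rewrite ifN; last by rewrite -val_eqE -lt0n.
  by apply/seteqP; split => // z [dz []].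
Qed.

End covers.

Theorem theorem1p3 (R : realType) (X : topologicalType) :
  @ANR R X -> @path_connected R X ->
  [/\ TCFH R X = TCFHg R X, TCFHg R X = TCDM R X,
      TCDM R X = TCM R X & TCM R X = TCMg R X].
Proof.
move=> ANR_X _.
(* For each [n] the five implications close into a cycle, so the five cover predicates coincide and
   so do their least values. *)
have FH_FHg := @TCFH_FHg R X.
have FHg_DM := @TCFHg_DM R X ANR_X.
have DM_Mg := @TCDM_Mg R X ANR_X.
have Mg_M := @TCMg_M R X ANR_X.
have M_FH := @TCM_FH R X ANR_X.
by split; congr (least_or_inf _); apply/funext => n; apply/propext; split; auto 6.
Qed.
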